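(* Let $c,\delta$ be fixed real constants with $0 \le \delta \le c$. If $\delta < \sqrt{c}$, then there is a constant $C = C(c,\delta)$ such that for every $n \ge 1$ there exists a coupling $\mu \in \Pi(\mathbf{P}_n,\mathbf{Q}_n)$ with $$\mathbf{E}_{\mu}\left[\mathrm{d}_1(G,H)\right] \le C\sqrt{n}, \qquad (G,H)\sim\mu;$$ that is, $\mathbf{P}_n$ and $\mathbf{Q}_n$ can be coupled to expected edit distance $O(\sqrt n)$ as $n\to\infty$.
   Context: A kernel is a symmetric measurable function $\kappa:[0,1]^2\to\mathbb{R}$. For a bounded kernel $\kappa$, the random graph $G(n,\kappa)$ on vertex set $\{1,\dots,n\}$ is sampled as follows: draw $x_1,\dots,x_n$ i.i.d. uniform on $[0,1]$, and then, conditionally on these, place each edge $\{i,j\}$ ($i<j$) independently with probability $\kappa(x_i,x_j)/n$ (this value being projected into $[0,1]$ if necessary). For constants $0\le\delta\le c$, let $\kappa_1\equiv c$, and let $\kappa_2$ be the kernel equal to $c-\delta$ on $([0,1/2]\times[1/2,1])\cup([1/2,1]\times[0,1/2])$ and equal to $c+\delta$ elsewhere on $[0,1]^2$. Let $\mathbf{Q}_n$ denote the law of $G(n,\kappa_1)$ and $\mathbf{P}_n$ the law of $G(n,\kappa_2)$. Equivalently, $\mathbf{P}_n$ is the stochastic block model in which vertices get i.i.d. uniform spins $\sigma_i\in\{-1,1\}$ and edge $\{i,j\}$ is present independently with probability $(c+\delta)/n$ if $\sigma_i\sigma_j=1$ and $(c-\delta)/n$ otherwise (projected into $[0,1]$ if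 necessary). For graphs $G,H$ on the same $n$-element vertex set, the edit distance is $\mathrm{d}_1(G,H)=\min_{G'\cong G}|E(G')\triangle E(H)|$, the minimum being over graphs $G'$ on that vertex set isomorphic to $G$. $\Pi(\mathbf{P}_n,\mathbf{Q}_n)$ is the set of couplings, i.e. joint laws of pairs $(G,H)$ with $G\sim\mathbf{P}_n$ and $H\sim\mathbf{Q}_n$. *)

(* Defs.v *)
From HB Require Import structures.
From mathcomp Require Import all_boot all_order all_fingroup all_algebra.
From mathcomp Require Import all_classical all_reals all_analysis.
From mathcomp Require Import measurable_realfun.

Set Implicit Arguments.
Unset Strict Implicit.
Unset Printing Implicit Defensive.

Import Order.TTheory GRing.Theory Num.Theory.
Import numFieldNormedType.Exports.

Local Open Scope classical_set_scope.
Local Open Scope ring_scope.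

(* Probability laws on a finite set, given by their mass function. *)
Record law (R : realType) (T : finType) := Law {
  law_pmf :> T -> R ;
  law_ge0 : forall t, 0 <= law_pmf t ;
  law_sum1 : \sum_t law_pmf t = 1 }.

Definition law_expectation (R : realType) (T : finType) (mu : law R T)
    (f : T -> R) : R :=
  \sum_t mu t * f t.

Definition coupling (R : realType) (S T : finType)
    (P : law R S) (Q : law R T) (mu : law R (S * T)%type) : Prop :=
  (forall s, \sum_t mu (s, t) = P s) /\ (forall t, \sum_s mu (s, t) = Q t).

(* Simple graphs on the vertex set 'I_n: an edge is a two-element set. *)
Record sgraph (n : nat) := SGraph {
  edges :> {set {set 'I_n}} ;
  edges_card2 : [forall e in edges, #|e| == 2%N] }.

HB.instance Definition _ n := [isSub for @edges n].
HB.instance Definition _ n := [Finite of sgraph n by <:].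

Section Edit.
Variable n : nat.
Implicit Types G H : sgraph n.

Definition isomorphic G H : bool :=
  [exists s : {perm 'I_n},
    edges H == [set s @: (e : {set 'I_n}) | e in edges G]%SET].

Definition symdiff_card G H : nat :=
  #|((edges G :\: edges H) :|: (edges H :\: edges G))%SET|.

Definition edit_distance G H : nat :=
  symdiff_card
    [arg min_(G' < G | isomorphic G G') symdiff_card G' H] H.

Lemma isomorphic_refl G : isomorphic G G.
Proof.
apply/existsP; exists 1%g; apply/eqP/setP => e.
have E : (fun e0 : {set 'I_n} => ((1%g : {perm 'I_n}) @: e0)%SET) =1 id.
  move=> e0; rewrite -[RHS]imset_id; apply: eq_imset => i.
  by rewrite perm1.
by rewrite (eq_imset _ E) imset_id.
Qed.

Lemma edit_distance_min G H :
  (exists2 G', isomorphic G G' & edit_distance G H = symdiff_card G' H) /\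
  (forall G', isomorphic G G' -> (edit_distance G H <= symdiff_card G' H)%N).
Proof.
rewrite /edit_distance.
case: arg_minnP => [|G' isoG' minG']; first exact: isomorphic_refl.
by split => //; exists G'.
Qed.

End Edit.

(* The law of n independent draws from P. *)
Section Iid.
Context (R : realType) (d : measure_display) (T : measurableType d).

Definition tuple_cons (n : nat) (x : T * n.-tuple T) : n.+1.-tuple T :=
  [tuple of x.1 :: x.2].

Lemma measurable_tuple_cons n : measurable_fun setT (@tuple_cons n).
Proof. exact: measurable_cons. Qed.

HB.instance Definition _ n :=
  isMeasurableFun.Build _ _ _ _ (@tuple_cons n) (@measurable_tuple_cons n).

Fixpoint iid (P : probability T R) (n : nat) : probability (n.-tuple T) R :=
  match n return probability (n.-tuple T) R with
  | 0 => \d_ [tuple]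
  | m.+1 => distribution (P \x iid P m)%E (@tuple_cons m)
  end.

End Iid.

Definition unit_itv (R : realType) : set (measurableTypeR R) :=
  `[0, 1]%classic.

(* Bounded kernels, as functions on R^2 of which only the restriction to
   [0,1]^2 matters. *)
Record graph_kernel (R : realType) := GraphKernel {
  kernel_fun :> R -> R -> R ;
  kernel_sym : forall x y : R, unit_itv x -> unit_itv y ->
    kernel_fun x y = kernel_fun y x ;
  kernel_measurable : measurable_fun (@unit_itv R `*` @unit_itv R)
    (fun z : measurableTypeR R * measurableTypeR R => kernel_fun z.1 z.2) ;
  kernel_bounded : exists M : R, forall x y : R, unit_itv x -> unit_itv y ->
    `|kernel_fun x y| <= M }.

Definition unit_cube (R : realType) (n : nat) :
    set (n.-tuple (measurableTypeR R)) :=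
  [set x | forall i, unit_itv (tnth x i)].

Definition uniform_cube (R : realType) (n : nat) :
    probability (n.-tuple (measurableTypeR R)) R :=
  iid (uniform_prob (@ltr01 R)) n.

Lemma measurable_unit_cube (R : realType) n :
  measurable (@unit_cube R n).
Proof.
rewrite (_ : @unit_cube R n =
    \bigcap_(i in [set: 'I_n]) ((fun x => tnth x i) @^-1` @unit_itv R)).
  apply: fin_bigcap_measurable => // i _.
  rewrite -[X in measurable X]setTI.
  by apply: measurable_tnth => //; exact: measurable_itv.
by apply/seteqP; split => x h i; [move=> _|]; exact: (h i).
Qed.

Lemma uniform_cube1 (R : realType) n : uniform_cube R n (@unit_cube R n) = 1%E.
Proof.
elim: n => [|n IH].
  rewrite /uniform_cube /= diracE mem_set // => -[] //.
rewrite /uniform_cube /= /distribution /pushforward.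
rewrite (_ : _ @^-1` _ = @unit_itv R `*` @unit_cube R n); last first.
  apply/seteqP; split => -[x t] /=.
    move=> h; split; first exact: (h ord0).
    by move=> i; have := h (lift ord0 i); rewrite tnthS.
  move=> [hx ht] i; case: (unliftP ord0 i) => [j ->|-> //].
  by rewrite tnthS; exact: (ht j).
rewrite product_measure1E //.
- rewrite -/(uniform_cube R n) [X in (_ * X)%E]IH mule1.
  exact: integral_uniform_pdf1.
- exact: measurable_itv.
- exact: measurable_unit_cube.
Qed.

Section RandomGraph.
Variables (R : realType) (k : graph_kernel R) (n : nat).

Definition edge_prob (x y : R) : R := Num.max 0 (Num.min 1 (k x y / n%:R)).

(* Probability of G given that vertex i has type tnth x i; each edge {i,j} is
   counted once, through its representative with i < j. *)
Definition graph_cond_prob (x : n.-tuple (measurableTypeR R))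
    (G : sgraph n) : R :=
  \prod_(p : 'I_n * 'I_n | (p.1 < p.2)%N)
    if [set p.1; p.2]%SET \in edges G
    then edge_prob (tnth x p.1) (tnth x p.2)
    else 1 - edge_prob (tnth x p.1) (tnth x p.2).

Definition random_graph_prob (G : sgraph n) : R :=
  \int[uniform_cube R n]_(x in @unit_cube R n) graph_cond_prob x G.

Lemma edge_prob_itv x y : 0 <= edge_prob x y <= 1.
Proof. by rewrite /edge_prob le_max ge_max ge_min !lexx ler01. Qed.

Lemma graph_cond_prob_ge0 x G : 0 <= graph_cond_prob x G.
Proof.
apply: prodr_ge0 => p _; case: ifP => _; last rewrite subr_ge0.
  by case/andP: (edge_prob_itv (tnth x p.1) (tnth x p.2)).
by case/andP: (edge_prob_itv (tnth x p.1) (tnth x p.2)).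
Qed.

Local Notation pair := {p : 'I_n * 'I_n | (p.1 < p.2)%N}.

Definition edge_of (p : pair) : {set 'I_n} := [set (val p).1; (val p).2]%SET.

Lemma edge_of_inj : injective edge_of.
Proof.
move=> [[a b] /= ab] [[a' b'] /= ab']; rewrite /edge_of /= => E.
apply: val_inj => /=.
have ha : a \in [set a'; b']%SET by rewrite -E !inE eqxx.
have hb : b \in [set a'; b']%SET by rewrite -E !inE eqxx orbT.
have ha' : a' \in [set a; b]%SET by rewrite E !inE eqxx.
move: ha hb ha' ab ab'; rewrite !inE.
case/orP=> /eqP->; case/orP=> /eqP->; rewrite ?ltnn ?eqxx //.
by move=> _ h1 h2; have := ltn_trans h1 h2; rewrite ltnn.
Qed.

Lemma edge_of_surj (e : {set 'I_n}) : #|e| = 2%N -> exists p, e = edge_of p.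
Proof.
move=> /eqP/cards2P[a [b [ab ->]]].
have : (a < b)%N || (b < a)%N by rewrite -neq_ltn.
case/orP=> h; first by exists (exist _ (a, b) h).
by exists (exist _ (b, a) h); rewrite /edge_of /= finset.setUC.
Qed.

Lemma graph_of_subproof (A : {set pair}) :
  [forall e in (edge_of @: A)%SET, #|e| == 2%N].
Proof.
apply/forallP => e; apply/implyP => /imsetP[[[a b] /= ab] _ ->].
by rewrite cards2 /= neq_ltn ab.
Qed.

Definition graph_of (A : {set pair}) : sgraph n :=
  SGraph (graph_of_subproof A).

Definition pairs_of (G : sgraph n) : {set pair} :=
  [set p | edge_of p \in edges G]%SET.

Lemma graph_ofK : cancel graph_of pairs_of.
Proof.
by move=> A; apply/setP => p; rewrite inE /= mem_imset //; exact: edge_of_inj.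
Qed.

Lemma pairs_ofK : cancel pairs_of graph_of.
Proof.
move=> G; apply: val_inj => /=; apply/setP => e; apply/imsetP/idP.
  by move=> [p]; rewrite inE => + ->.
move=> eG; have /forallP/(_ e) := edges_card2 G.
rewrite eG => /eqP/edge_of_surj[p pE]; exists p => //.
by rewrite inE -pE.
Qed.

Lemma sum_graph_cond_prob x : \sum_G graph_cond_prob x G = 1.
Proof.
rewrite (reindex graph_of) /=; last first.
  by apply: onW_bij; exists pairs_of; [exact: graph_ofK|exact: pairs_ofK].
pose q (p : pair) := edge_prob (tnth x (val p).1) (tnth x (val p).2).
transitivity (\prod_(p : pair) (q p + (1 - q p))); last first.
  by rewrite big1 // => p _; rewrite addrC subrK.
rewrite bigA_distr; apply: eq_bigr => A _.
rewrite /graph_cond_prob.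
rewrite (big_sub [pred p : 'I_n * 'I_n | (p.1 < p.2)%N]) /=.
apply: eq_bigr => p _.
by rewrite -/(edge_of p) mem_imset //; exact: edge_of_inj.
Qed.

Lemma measurable_edge_prob i j : measurable_fun (@unit_cube R n)
  (fun x => edge_prob (tnth x i) (tnth x j)).
Proof.
apply: measurable_maxr => //; apply: measurable_minr => //.
apply: measurable_funM => //.
pose g (x : n.-tuple (measurableTypeR R)) := (tnth x i, tnth x j).
apply: (@measurable_comp _ _ _ _ _ _ (@unit_itv R `*` @unit_itv R)
  (fun z : measurableTypeR R * measurableTypeR R => k z.1 z.2) _ g).
- by apply: measurableX; exact: measurable_itv.
- by move=> _ [x xI <-]; split; [exact: (xI i)|exact: (xI j)].
- exact: kernel_measurable.
- apply: measurable_funTS; apply: measurable_fun_pair; exact: measurable_tnth.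
Qed.

Lemma measurable_graph_cond_prob G :
  measurable_fun (@unit_cube R n) (graph_cond_prob ^~ G).
Proof.
rewrite /graph_cond_prob.
under eq_fun do rewrite big_mkcond.
apply: measurable_prod => p _.
case: (p.1 < p.2)%N => //.
case: ([set p.1; p.2]%SET \in edges G); first exact: measurable_edge_prob.
by apply: measurable_funB => //; exact: measurable_edge_prob.
Qed.

Lemma random_graph_prob_ge0 G : 0 <= random_graph_prob G.
Proof. by apply: Rintegral_ge0 => x _; exact: graph_cond_prob_ge0. Qed.

Lemma integrable_graph_cond_prob G : (uniform_cube R n).-integrable
  (@unit_cube R n) (EFin \o graph_cond_prob ^~ G).
Proof.
apply: (@le_integrable _ _ _ _ _ _ _ (cst 1%E)).
- exact: measurable_unit_cube.
- by apply/measurable_EFinP; exact: measurable_graph_cond_prob.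
- move=> x _ /=; rewrite lee_fin normr1 ger0_norm ?graph_cond_prob_ge0 //.
  rewrite -(sum_graph_cond_prob x) (bigD1 G) //= lerDl.
  by apply: sumr_ge0 => G' _; exact: graph_cond_prob_ge0.
- by apply: finite_measure_integrable_cst; exact: measurable_unit_cube.
Qed.

Lemma random_graph_prob_sum1 : \sum_G random_graph_prob G = 1.
Proof.
apply: EFin_inj; rewrite -sumEFin.
under eq_bigr => G _.
  rewrite /random_graph_prob /Rintegral fineK; last first.
    apply: integrable_fin_num; first exact: measurable_unit_cube.
    exact: integrable_graph_cond_prob.
  over.
rewrite -integral_sum; last by move=> G; exact: integrable_graph_cond_prob.
  under eq_integral do rewrite sumEFin sum_graph_cond_prob.
  rewrite (integral_cst _ (@measurable_unit_cube R n)).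
  by rewrite [X in (_ * X)%E]uniform_cube1 mule1.
exact: measurable_unit_cube.
Qed.

Definition random_graph : law R (sgraph n) :=
  Law random_graph_prob_ge0 random_graph_prob_sum1.

End RandomGraph.

Section Kernels.
Variables (R : realType) (c delta : R).

Definition kernel1_fun (x y : R) : R := c.

Lemma kernel1_measurable : measurable_fun (@unit_itv R `*` @unit_itv R)
  (fun z : measurableTypeR R * measurableTypeR R => kernel1_fun z.1 z.2).
Proof. exact: measurable_cst. Qed.

Lemma kernel1_bounded : exists M : R, forall x y : R,
  unit_itv x -> unit_itv y -> `|kernel1_fun x y| <= M.
Proof. by exists `|c|. Qed.

Definition kernel1 : graph_kernel R :=
  @GraphKernel R kernel1_fun (fun _ _ _ _ => erefl)
    kernel1_measurable kernel1_bounded.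

Definition off_diagonal_blocks : set (measurableTypeR R * measurableTypeR R) :=
  (`[0, 2^-1]%classic `*` `[2^-1, 1]%classic) `|`
  (`[2^-1, 1]%classic `*` `[0, 2^-1]%classic).

Definition kernel2_fun (x y : R) : R :=
  if (x, y) \in off_diagonal_blocks then c - delta else c + delta.

Lemma off_diagonal_blocksC x y :
  ((x, y) \in off_diagonal_blocks) = ((y, x) \in off_diagonal_blocks).
Proof.
by apply/idP/idP; rewrite !inE => -[[? ?]|[? ?]]; [right|left|right|left].
Qed.

Lemma measurable_off_diagonal_blocks : measurable off_diagonal_blocks.
Proof. by apply: measurableU; apply: measurableX; exact: measurable_itv. Qed.

Lemma kernel2_sym (x y : R) : unit_itv x -> unit_itv y ->
  kernel2_fun x y = kernel2_fun y x.
Proof. by move=> _ _; rewrite /kernel2_fun (off_diagonal_blocksC x y). Qed.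

Lemma kernel2_measurable : measurable_fun (@unit_itv R `*` @unit_itv R)
  (fun z : measurableTypeR R * measurableTypeR R => kernel2_fun z.1 z.2).
Proof.
apply: measurable_funTS; apply: measurable_fun_ifT => //=.
apply: (measurable_fun_bool true).
rewrite setTI (_ : _ @^-1` _ = off_diagonal_blocks).
  exact: measurable_off_diagonal_blocks.
by apply/seteqP; split => -[x y] /=; [move/set_mem|move/mem_set].
Qed.

Lemma kernel2_bounded : exists M : R, forall x y : R,
  unit_itv x -> unit_itv y -> `|kernel2_fun x y| <= M.
Proof.
exists (`|c| + `|delta|) => x y _ _; rewrite /kernel2_fun.
by case: ifP => _; [exact: ler_normB | exact: ler_normD].
Qed.

Definition kernel2 : graph_kernel R :=
  GraphKernel kernel2_sym kernel2_measurable kernel2_bounded.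

End Kernels.

Definition lawQ (R : realType) (c : R) (n : nat) : law R (sgraph n) :=
  random_graph (kernel1 c) n.

Definition lawP (R : realType) (c delta : R) (n : nat) : law R (sgraph n) :=
  random_graph (kernel2 c delta) n.

(* Main.v *)
Require Import Defs.
From HB Require Import structures.
From mathcomp Require Import all_boot all_order all_fingroup all_algebra.
From mathcomp Require Import all_classical all_reals all_analysis.
From mathcomp Require Import measurable_realfun ring lra.

Set Implicit Arguments.
Unset Strict Implicit.
Unset Printing Implicit Defensive.

Import Order.TTheory GRing.Theory Num.Theory.
Import numFieldNormedType.Exports.
Local Open Scope ring_scope.

(** The idea is to turn a bounded second moment of the likelihood ratio into a
    coupling, with no relabelling of the vertices: the coupling found is already
    within O(sqrt n) for the number of edges on which the two labelled graphs
    differ, and this number bounds the edit distance.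

    Below the threshold delta ^ 2 < c the likelihood ratio L = dP/dQ has a
    second moment under Q that is bounded for large n.  Writing P as the average
    over spins s in {-1, 1}^n of product measures on edges, E_Q (L ^ 2) is an
    average over pairs of spin vectors s, t of a product over edges of
    1 + a (s_i t_i) (s_j t_j), with a = delta ^ 2 / (c (n - c)).  The vector
    u = s t is again uniform, so E_Q (L ^ 2) is at most the mean of
    exp (a (sum u) ^ 2 / 2), which is bounded because a n stays below a constant
    smaller than 1 ([sum_expR_sqr_le], [sum_spin_mixture_sqr_le]).

    A bounded second moment gives a good coupling because Q is a product of
    about n ^ 2 / 2 Bernoulli (c / n) laws, of total variance O(n).  Revealing
    the edges one by one and coupling each optimally given the past, the expected
    number of disagreements is the sum over edges of p (1 - p) times the mean of
    |L(edge present) - L(edge absent)|, where L is the martingale of conditional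
    means.  By Cauchy-Schwarz and orthogonality of martingale increments it is at
    most the square root of (total variance of the edges) * Var_Q L, that is
    O(sqrt n).  [transport_inequality] is the form of this bound, linearised by a
    parameter t, that passes to products ([transport_inequality_prod]) and so
    needs to be proved for a single edge only
    ([transport_inequality_bernoulli]).

    What remains is to see that the types enter only through the half of [0,1]
    that they fall in ([random_graph_block]), and that for the finitely many
    small n, where some edge probability may be truncated or the bound on a may
    fail, any coupling will do. *)

Local Notation pair n := {e : 'I_n * 'I_n | (e.1 < e.2)%N}.

(** * A transport inequality stable under products *)

Lemma sum_pair (R : realType) (S T : finType) (F : S * T -> R) :
  \sum_z F z = \sum_x \sum_y F (x, y).
Proof. by rewrite pair_bigA; apply: eq_bigr => -[]. Qed.

(** Here mu couples the measure L q with its mass times q, and optimising over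
    t would bound its d-cost by sqrt (v Var_q L).  The bound is kept linear in
    the variance so that it can be summed over the fibres of a product, and L is
    not normalised so that conditioning never divides by a mass. *)
Definition transport_inequality (R : realType) (T : finType)
    (q : T -> R) (d : T -> T -> R) (v : R) : Prop :=
  forall (L : T -> R) (t : R), (forall x, 0 <= L x) -> 0 < t ->
  exists mu : T -> T -> R,
    [/\ forall x y, 0 <= mu x y,
        forall x, \sum_y mu x y = q x * L x,
        forall y, \sum_x mu x y = (\sum_x q x * L x) * q y
      & 2 * (\sum_x \sum_y mu x y * d x y)
          <= t * (\sum_x q x * L x ^+ 2 - (\sum_x q x * L x) ^+ 2) + v / t].

Lemma transport_inequality_bij (R : realType) (S T : finType) (f : S -> T)
    (q : T -> R) (q' : S -> R) (d : T -> T -> R) (d' : S -> S -> R) (v : R) :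
  bijective f -> (forall x, q' x = q (f x)) ->
  (forall x y, d' x y <= d (f x) (f y)) ->
  transport_inequality q d v -> transport_inequality q' d' v.
Proof.
move=> bf qE dle tr L t L0 t0.
have [g fK gK] := bf.
have E (F : S -> R) : \sum_x F x = \sum_y F (g y).
  by rewrite (reindex g) //; exists f => x _; rewrite ?fK ?gK.
have [mu [mu0 mu1 mu2 mu3]] := tr (L \o g) t (fun x => L0 _) t0.
exists (fun x y => mu (f x) (f y)); split=> //.
- by move=> x; rewrite E; under eq_bigr do rewrite gK; rewrite mu1 /= fK qE.
- move=> y; rewrite E; under eq_bigr do rewrite gK; rewrite mu2 /= qE.
  by congr (_ * _); rewrite E; apply: eq_bigr => x _; rewrite qE gK.
- rewrite !E.
  under [X in _ <= t * (X - _) + _]eq_bigr do rewrite qE gK.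
  under [X in _ <= t * (_ - X ^+ 2) + _]eq_bigr do rewrite qE gK.
  apply: le_trans mu3; rewrite ler_pM2l //.
  apply: ler_sum => x _; rewrite E; apply: ler_sum => y _.
  rewrite !gK; apply: ler_wpM2l => //.
  by apply: le_trans (dle _ _) _; rewrite !gK.
Qed.

(** Couple the first coordinates through the conditional mean l of L, then the
    second coordinates inside the fibre of the first one; in the second marginal
    the fibres all carry multiples of q2, so the marginal is a product.  The
    costs add up to the claim because the variance of L is the variance of l plus
    the mean of the conditional variances. *)
Lemma transport_inequality_prod (R : realType) (S T : finType)
    (q1 : S -> R) (q2 : T -> R) (d1 : S -> S -> R) (d2 : T -> T -> R)
    (v1 v2 : R) :
  (forall x, 0 <= q1 x) -> \sum_x q1 x = 1 ->
  (forall y, 0 <= q2 y) -> \sum_y q2 y = 1 ->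
  transport_inequality q1 d1 v1 -> transport_inequality q2 d2 v2 ->
  transport_inequality (fun z : S * T => q1 z.1 * q2 z.2)
    (fun z w => d1 z.1 w.1 + d2 z.2 w.2) (v1 + v2).
Proof.
move=> q10 q11 q20 q21 tr1 tr2 L t L0 t0.
pose l x := \sum_y q2 y * L (x, y).
have l0 x : 0 <= l x by apply: sumr_ge0 => y _; rewrite mulr_ge0.
have [nu [nu0 nu1 nu2 nu3]] := tr1 l t l0 t0.
have /boolp.choice[mu muP] : forall x, exists mu : T -> T -> R,
    [/\ forall y z, 0 <= mu y z,
        forall y, \sum_z mu y z = q2 y * L (x, y),
        forall z, \sum_y mu y z = l x * q2 z
      & 2 * (\sum_y \sum_z mu y z * d2 y z)
          <= t * (\sum_y q2 y * L (x, y) ^+ 2 - l x ^+ 2) + v2 / t].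
  by move=> x; apply: tr2 => // y; exact: L0.
have l_eq0 x y : l x = 0 -> q2 y * L (x, y) = 0.
  move=> /psumr_eq0P -> // i _; by rewrite mulr_ge0.
have nu_eq0 x y : l x = 0 -> nu x y = 0.
  move=> lx0; have := nu1 x; rewrite lx0 mulr0 => h.
  exact: (psumr_eq0P (fun z _ => nu0 x z) h).
have mu_eq0 x y z : l x = 0 -> mu x y z = 0.
  move=> lx0; have [mu0 mu1 _ _] := muP x.
  have := mu1 y; rewrite l_eq0 // => h.
  exact: (psumr_eq0P (fun z _ => mu0 y z) h).
have nul x y : nu x y * l x / l x = nu x y.
  have [lx0|lx0] := eqVneq (l x) 0; last by rewrite mulfK.
  by rewrite nu_eq0 // !mul0r.
have mE : \sum_z q1 z.1 * q2 z.2 * L z = \sum_x q1 x * l x.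
  rewrite sum_pair; apply: eq_bigr => x _; rewrite mulr_sumr.
  by apply: eq_bigr => y _; rewrite mulrA.
exists (fun z w => nu z.1 w.1 * mu z.1 z.2 w.2 / l z.1); split.
- move=> z w; rewrite divr_ge0 ?mulr_ge0 //.
  by have [mu0 _ _ _] := muP z.1; exact: mu0.
- move=> [x x2]; rewrite sum_pair /=; have [_ mu1 _ _] := muP x.
  under eq_bigr do rewrite -mulr_suml -mulr_sumr mu1 mulrAC.
  rewrite -mulr_suml -mulr_suml nu1.
  have [lx0|lx0] := eqVneq (l x) 0.
    by rewrite -[RHS]mulrA l_eq0 // lx0 !(mulr0, mul0r).
  by field.
- move=> [y y2]; rewrite sum_pair /= mE mulrA -nu2 mulr_suml.
  apply: eq_bigr => x _; rewrite -mulr_suml -mulr_sumr.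
  by have [_ _ mu2 _] := muP x; rewrite mu2 mulrA mulrAC nul.
pose cost2 x := \sum_y \sum_z mu x y z * d2 y z.
have -> : \sum_z \sum_w nu z.1 w.1 * mu z.1 z.2 w.2 / l z.1 *
      (d1 z.1 w.1 + d2 z.2 w.2) =
    \sum_x \sum_y nu x y * d1 x y + \sum_x q1 x * cost2 x.
  rewrite sum_pair -big_split; apply: eq_bigr => x _ /=.
  under eq_bigr do rewrite sum_pair /=.
  rewrite exchange_big /=.
  transitivity (\sum_y (nu x y * d1 x y + nu x y / l x * cost2 x)).
    apply: eq_bigr => y _.
    transitivity (\sum_(x2 : T) (nu x y / l x * d1 x y * (\sum_z mu x x2 z) +
        nu x y / l x * \sum_z mu x x2 z * d2 x2 z)).
      apply: eq_bigr => x2 _; rewrite !mulr_sumr -big_split /=.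
      by apply: eq_bigr => z _; ring.
    rewrite big_split /= -mulr_sumr; congr (_ + _); last by rewrite -mulr_sumr.
    have [_ mu1 _ _] := muP x.
    under eq_bigr do rewrite mu1.
    by rewrite -/(l x) -{2}[nu x y]nul; ring.
  rewrite big_split /= -mulr_suml -mulr_suml nu1; congr (_ + _).
  have [lx0|lx0] := eqVneq (l x) 0; last by rewrite mulfK.
  rewrite (_ : cost2 x = 0) ?mulr0 //.
  by apply: big1 => y _; apply: big1 => z _; rewrite mu_eq0 // mul0r.
have cost2_le : 2 * \sum_x q1 x * cost2 x <=
    t * (\sum_x \sum_y q1 x * q2 y * L (x, y) ^+ 2 - \sum_x q1 x * l x ^+ 2)
    + v2 / t.
  have -> : v2 / t = \sum_x q1 x * (v2 / t) by rewrite -mulr_suml q11 mul1r.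
  rewrite -sumrB !mulr_sumr -big_split /=.
  apply: ler_sum => x _; have [_ _ _ mu3] := muP x.
  have := ler_wpM2l (q10 x) mu3; rewrite -/(cost2 x).
  rewrite [X in _ -> _ <= t * (X - _) + _](_ : _ =
    q1 x * \sum_y q2 y * L (x, y) ^+ 2).
    by lra.
  by rewrite mulr_sumr; apply: eq_bigr => y _; rewrite mulrA.
rewrite mE sum_pair (mulrDr 2) /=.
by lra.
Qed.

(** The optimal coupling of the measure L q with its mass times q costs
    p (1 - p) |L true - L false|, while the variance of L is
    p (1 - p) (L true - L false) ^ 2; the claim is 2 |x| <= t x ^ 2 + 1 / t. *)
Lemma transport_inequality_bernoulli (R : realType) (p : R) : 0 <= p <= 1 ->
  transport_inequality (fun b : bool => if b then p else 1 - p)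
    (fun a b => (a != b)%:R) (p * (1 - p)).
Proof.
move=> /andP[p0 p1] L t L0 t0.
have sumb (F : bool -> R) : \sum_b F b = F true + F false by exact: big_bool.
pose m := p * L true + (1 - p) * L false.
have q0 : 0 <= 1 - p by rewrite subr_ge0.
have m0 : 0 <= m by rewrite addr_ge0 ?mulr_ge0.
have D2 (x : R) : 2 * `|x| <= t * x ^+ 2 + 1 / t.
  rewrite -subr_ge0 (_ : _ - _ = t * (`|x| - 1 / t) ^+ 2).
    by rewrite mulr_ge0 ?sqr_ge0 // ltW.
  by rewrite -real_normK ?num_real //; field; rewrite gt_eqF.
have cost_le : 2 * (p * (1 - p) * `|L true - L false|) <=
    t * (p * L true ^+ 2 + (1 - p) * L false ^+ 2 - m ^+ 2) + p * (1 - p) / t.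
  have := ler_wpM2l (mulr_ge0 p0 q0) (D2 (L true - L false)).
  by rewrite /m; lra.
have [Lle|Lge] := leP (L false) (L true).
(* Mass p m + (1 - p) L false stays on the diagonal; the excess on one side
   moves to the other. *)
- exists (fun a b => match a, b with
      | true, true => p * m
      | true, false => p * (L true - m)
      | false, true => 0
      | false, false => (1 - p) * L false end).
  have mE : L true - m = (1 - p) * (L true - L false) by rewrite /m; ring.
  split.
  + move=> [] [] //; rewrite ?mulr_ge0 //.
    by rewrite mE mulr_ge0 ?subr_ge0.
  + by move=> []; rewrite sumb //; ring.
  + by move=> []; rewrite !sumb /m //; ring.
  + rewrite !sumb /= -/m !mulr0 !mulr1 !add0r !addr0 mE.
    by rewrite ger0_norm ?subr_ge0 // -[p * _ * _]mulrA in cost_le.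
- exists (fun a b => match a, b with
      | true, true => p * L true
      | true, false => 0
      | false, true => (1 - p) * (L false - m)
      | false, false => (1 - p) * m end).
  have mE : L false - m = p * (L false - L true) by rewrite /m; ring.
  split.
  + move=> [] [] //; rewrite ?mulr_ge0 //.
    by rewrite mE mulr_ge0 ?subr_ge0 // ltW.
  + by move=> []; rewrite sumb //; ring.
  + by move=> []; rewrite !sumb /m //; ring.
  + rewrite !sumb /= -/m !mulr0 !mulr1 !add0r !addr0 mE.
    have h : `|L true - L false| = L false - L true.
      by rewrite distrC ger0_norm // subr_ge0 ltW.
    have E : (1 - p) * (p * (L false - L true)) =
        p * (1 - p) * (L false - L true) by ring.
    by rewrite E -h.
Qed.

Lemma sum_tuple_cons (R : realType) (T : finType) n (F : n.+1.-tuple T -> R) :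
  \sum_u F u = \sum_x \sum_(u : n.-tuple T) F [tuple of x :: u].
Proof.
rewrite -(sum_pair (fun z : T * n.-tuple T => F [tuple of z.1 :: z.2])).
rewrite (reindex (fun z : T * n.-tuple T => [tuple of z.1 :: z.2])) //.
exists (fun u => (thead u, [tuple of behead u])) => [[x u] _|u _] /=.
  by rewrite theadE; congr (_, _); apply: val_inj.
by rewrite -tuple_eta.
Qed.

Lemma tnth_lift0 (T : Type) n (u : n.+1.-tuple T) (i : 'I_n) :
  tnth u (lift ord0 i) = tnth [tuple of behead u] i.
Proof. by rewrite [u in LHS]tuple_eta tnthS. Qed.

Lemma prod_tuple_cons (R : realType) (T : finType) n (F : T -> R)
    (u : n.+1.-tuple T) :
  \prod_i F (tnth u i) = F (thead u) * \prod_i F (tnth [tuple of behead u] i).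
Proof.
rewrite big_ord_recl; congr (_ * _).
by apply: eq_bigr => i _; rewrite tnth_lift0.
Qed.

Lemma sum_tuple0 (R : realType) (T : finType) (F : 0.-tuple T -> R) :
  \sum_u F u = F [tuple].
Proof. by rewrite (bigD1 [tuple]) //= big1 ?addr0 // => u; rewrite tuple0. Qed.

Lemma sum_prod_tuple (R : realType) (T : finType) (q : T -> R) n :
  \sum_(u : n.-tuple T) \prod_i q (tnth u i) = (\sum_x q x) ^+ n.
Proof.
elim: n => [|n IH]; first by rewrite sum_tuple0 big_ord0.
rewrite sum_tuple_cons exprS -IH mulr_suml; apply: eq_bigr => x _.
rewrite mulr_sumr; apply: eq_bigr => u _.
rewrite prod_tuple_cons theadE; congr (_ * _); apply: eq_bigr => i _.
by congr (q (tnth _ _)); apply: val_inj.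
Qed.

Lemma transport_inequality_tuple (R : realType) (T : finType)
    (q : T -> R) (d : T -> T -> R) (v : R) n :
  (forall x, 0 <= q x) -> \sum_x q x = 1 -> transport_inequality q d v ->
  transport_inequality (fun u : n.-tuple T => \prod_i q (tnth u i))
    (fun u w => \sum_i d (tnth u i) (tnth w i)) (n%:R * v).
Proof.
move=> q0 q1 tr; elim: n => [|n IH].
  move=> L t L0 t0.
  exists (fun u w => L u); split=> //.
  - by move=> x; rewrite sum_tuple0 big_ord0 mul1r.
  - by move=> x; rewrite !sum_tuple0 !big_ord0 mul1r mulr1.
  - rewrite !sum_tuple0 !big_ord0 !mul1r mulr0 mulr0 subrr mulr0 mul0r add0r.
    by rewrite mul0r.
rewrite -add1n natrD mulrDl mul1r.
apply: (transport_inequality_bij (f := fun u : n.+1.-tuple T =>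
    (thead u, [tuple of behead u]))
    (q := fun z : T * n.-tuple T => q z.1 * \prod_i q (tnth z.2 i))
    (d := fun z w => d z.1 w.1 + \sum_i d (tnth z.2 i) (tnth w.2 i))).
- exists (fun z : T * n.-tuple T => [tuple of z.1 :: z.2]).
    by move=> u; rewrite /= -tuple_eta.
  by move=> [x u] /=; rewrite theadE; congr (_, _); apply: val_inj.
- by move=> u; rewrite prod_tuple_cons.
- move=> u w; rewrite big_ord_recl lerD2l; apply: ler_sum => i _ /=.
  by rewrite !tnth_lift0.
apply: (transport_inequality_prod (q1 := q) (d1 := d)
    (q2 := fun u : n.-tuple T => \prod_i q (tnth u i))
    (d2 := fun u w : n.-tuple T => \sum_i d (tnth u i) (tnth w i))) => //.
- by move=> u; apply: prodr_ge0.
- by rewrite sum_prod_tuple q1 expr1n.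
Qed.

(** * Transport for the Erdos-Renyi law *)

(** Unlike [graph_cond_prob] the product ranges over the type of edge slots, so
    that sums over graphs factor. *)
Definition edge_product (R : realType) n (w : pair n -> bool -> R)
    (G : sgraph n) : R :=
  \prod_e w e (edge_of e \in edges G).

Definition edge_indicators n (G : sgraph n) : #|{: pair n}|.-tuple bool :=
  [tuple edge_of (enum_val i) \in edges G | i < #|{: pair n}|].

Lemma edge_indicators_bij n : bijective (@edge_indicators n).
Proof.
exists (fun u => graph_of [set e : pair n | tnth u (enum_rank e)]%SET) => [G|u].
  rewrite -[RHS]pairs_ofK; congr graph_of; apply/setP => e.
  by rewrite !inE tnth_mktuple enum_rankK.
apply: eq_from_tnth => i; rewrite tnth_mktuple /= mem_imset.
  by rewrite inE enum_valK.
exact: edge_of_inj.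
Qed.

Lemma symdiff_card_le n (G H : sgraph n) :
  (symdiff_card G H <=
    \sum_(i < #|{: pair n}|)
      (tnth (edge_indicators G) i != tnth (edge_indicators H) i))%N.
Proof.
under eq_bigr do rewrite !tnth_mktuple.
pose differ (e : pair n) := (edge_of e \in edges G) != (edge_of e \in edges H).
rewrite -(big_enum_val (A := predT) (fun e => nat_of_bool (differ e))).
pose D := [set e | differ e]%SET.
rewrite -(_ : #|D| = \sum_(e in predT) differ e)%N; last first.
  rewrite -sum1_card big_mkcond /=; apply: eq_bigr => e _.
  by rewrite inE; case: (differ e).
apply: leq_trans (leq_imset_card (@edge_of n) D).
apply/subset_leq_card/fintype.subsetP => e.
rewrite !inE => eGH.
have /eqP/edge_of_surj[p pE] : #|e| == 2%N.
  have /forallP/(_ e) := edges_card2 G; have /forallP/(_ e) := edges_card2 H.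
  by case/orP: eGH => /andP[_ ->].
rewrite pE mem_imset; last exact: edge_of_inj.
by rewrite inE /differ -pE; move: eGH; do 2 case: (e \in _).
Qed.

Lemma transport_inequality_gnp (R : realType) n (p : R) : 0 <= p <= 1 ->
  transport_inequality
    (edge_product (fun (_ : pair n) (b : bool) => if b then p else 1 - p))
    (fun G H => (symdiff_card G H)%:R) (#|{: pair n}|%:R * (p * (1 - p))).
Proof.
move=> p01; have /andP[p0 p1] := p01.
have q0 (b : bool) : 0 <= (if b then p else 1 - p).
  by case: b; rewrite ?subr_ge0.
have q1 : \sum_(b : bool) (if b then p else 1 - p) = 1.
  by rewrite big_bool /= addrC subrK.
have tr := transport_inequality_tuple (n := #|{: pair n}|) q0 q1
    (transport_inequality_bernoulli p01).
apply: (transport_inequality_bij (edge_indicators_bij n) _ _ tr).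
  move=> G; rewrite /edge_product (big_enum_val (A := predT)) /=.
  by apply: eq_bigr => i _; rewrite tnth_mktuple.
by move=> G H; rewrite -natr_sum ler_nat symdiff_card_le.
Qed.

Lemma sum_edge_product (R : realType) n (w : pair n -> bool -> R) :
  \sum_G edge_product w G = \prod_e (w e true + w e false).
Proof.
rewrite (reindex (@graph_of n)) /=; last first.
  by apply: onW_bij; exists (@pairs_of n); [exact: graph_ofK|exact: pairs_ofK].
rewrite bigA_distr; apply: eq_bigr => A _.
apply: eq_bigr => e _; rewrite mem_imset; last exact: edge_of_inj.
by case: ifP.
Qed.

Lemma edge_productM (R : realType) n (w w' : pair n -> bool -> R) G :
  edge_product w G * edge_product w' G =
  edge_product (fun e b => w e b * w' e b) G.
Proof. by rewrite /edge_product -big_split. Qed.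

(** * Comparison of cosh with a Gaussian *)

Lemma le_of_is_derive_ge0 (R : realType) (f df : R -> R) (x : R) :
  (forall y : R, is_derive y (1 : R) f (df y)) ->
  (forall y, 0 <= y -> 0 <= df y) ->
  0 <= x -> f 0 <= f x.
Proof.
move=> fdf df0 x0.
have fc : {within `[0, x], continuous f}%classic.
  apply: continuous_subspaceT => y.
  by apply: differentiable_continuous; apply/derivable1_diffP; case: (fdf y).
have [c] := MVT_segment x0 (fun y _ => fdf y) fc.
rewrite in_itv /= => /andP[c0 _] E.
by rewrite -subr_ge0 E mulr_ge0 ?df0 ?subr_ge0.
Qed.

(** Both sides are even in x, and cosh y exp (- y ^ 2 / 2) decreases for y >= 0
    because sinh y <= y cosh y, which holds as y cosh y - sinh y has derivative
    y sinh y. *)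
Lemma expRD_expRN_le (R : realType) (x : R) :
  expR x + expR (- x) <= 2 * expR (x ^+ 2 / 2).
Proof.
wlog x0 : x / 0 <= x.
  move=> H; have [/H //|/ltW x0] := leP 0 x.
  have := H (- x); rewrite opprK sqrrN addrC; apply.
  by rewrite oppr_ge0.
pose em : R -> R := expR \o -%R.
have em_der (y : R) : is_derive y (1 : R) em (- em y).
  by apply: is_derive_eq; rewrite /em /= mulrN1.
pose ch : R -> R := expR + em.
pose sh : R -> R := expR - em.
have ch_der (y : R) : is_derive y (1 : R) ch (sh y) by exact: is_deriveD.
have sh_der (y : R) : is_derive y (1 : R) sh (ch y).
  by apply: is_derive_eq; rewrite opprK.
(* ch and sh are twice cosh and sinh. *)
pose f : R -> R := id * ch - sh.
have f_der (y : R) : is_derive y (1 : R) f (y * sh y).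
  by apply: is_derive_eq; rewrite /GRing.scale /=; ring.
have f_ge0 (y : R) : 0 <= y -> 0 <= f y.
  move=> y0; have f0 : f 0 = 0.
    by rewrite /f /sh /ch /em !fctE /= oppr0 mul0r !subrr.
  rewrite -f0; apply: (le_of_is_derive_ge0 f_der) => // z z0.
  rewrite mulr_ge0 // subr_ge0 /em /= ler_expR; lra.
pose e2 : R -> R := expR \o (- (id ^+ 2 * cst 2^-1)).
have e2_der (y : R) : is_derive y (1 : R) e2 (- y * e2 y).
  by apply: is_derive_eq; rewrite /GRing.scale /= /e2 !fctE /=; field.
pose g : R -> R := - (ch * e2).
have g_der (y : R) : is_derive y (1 : R) g (e2 y * f y).
  apply: is_derive_eq; rewrite /GRing.scale /= /f !fctE /=; ring.
have : g 0 <= g x.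
  apply: (le_of_is_derive_ge0 g_der) => // z z0.
  by rewrite mulr_ge0 ?f_ge0 // /e2 expR_ge0.
rewrite /g /e2 /ch /em !fctE /= lerN2 oppr0 expr0n /= mul0r oppr0 expR0.
by rewrite mulr1 [expR (- (_ / _))]expRN ler_pdivrMr ?expR_gt0 //.
Qed.

(** * Exponential moments of quadratic functions of spins *)

(** This stands in for the Gaussian integral that gives the mean of
    exp (S ^ 2 / (2 m)).  Averaging over one spin turns the coefficient
    1 / r into at most 1 / r + 1 / r ^ 2 <= 1 / (r - 1), by the bound on cosh;
    starting at r = m, the n spins leave r = m - n. *)
Lemma sum_expR_sqr_le (R : realType) n (s m : R) : n%:R < m ->
  \sum_(u : n.-tuple bool)
      expR ((s + \sum_i (-1) ^+ tnth u i) ^+ 2 / (2 * m))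
    <= 2 ^+ n * expR ((n%:R + s ^+ 2) / (2 * (m - n%:R))).
Proof.
elim: n s => [|n IH] s nm.
  by rewrite sum_tuple0 big_ord0 addr0 add0r subr0 mul1r.
rewrite -natr1 in nm *; pose r := m - n%:R.
have r1 : 1 < r by rewrite /r; lra.
have -> : m - (n%:R + 1) = r - 1 by rewrite /r; ring.
have nm' : n%:R < m by lra.
rewrite sum_tuple_cons.
have step b : \sum_(u : n.-tuple bool)
      expR ((s + \sum_i (-1) ^+ tnth [tuple of b :: u] i) ^+ 2 / (2 * m))
    <= 2 ^+ n * expR ((n%:R + (s + (-1) ^+ b) ^+ 2) / (2 * r)).
  apply: le_trans (IH (s + (-1) ^+ b) nm').
  apply: ler_sum => u _; rewrite big_ord_recl addrA.
  by under eq_bigr do rewrite tnthS.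
apply: le_trans (ler_sum _ (fun b _ => step b)) _.
(* The two values of the first spin combine into a cosh of s / r. *)
rewrite big_bool /= expr1 expr0 -mulrDr [2 ^+ n.+1]exprSr -mulrA.
rewrite ler_wpM2l ?exprn_ge0 //.
have E (e : R) : e ^+ 2 = 1 -> expR ((n%:R + (s + e) ^+ 2) / (2 * r)) =
    expR ((n%:R + 1 + s ^+ 2) / (2 * r)) * expR (e * s / r).
  move=> e2; rewrite -expRD; congr expR.
  have -> : (s + e) ^+ 2 = s ^+ 2 + 2 * s * e + e ^+ 2 by ring.
  by rewrite e2; field; rewrite gt_eqF //; lra.
rewrite !E ?sqrrN ?expr1n // mulN1r mul1r -mulrDr mulNr [expR (- _) + _]addrC.
have := ler_wpM2l (expR_ge0 ((n%:R + 1 + s ^+ 2) / (2 * r)))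
  (expRD_expRN_le (s / r)).
move/le_trans; apply.
rewrite mulrCA ler_pM2l // -expRD ler_expR.
have n0 : 0 <= n%:R :> R by [].
have s2 : 0 <= s ^+ 2 by exact: sqr_ge0.
rewrite -subr_ge0.
have -> : (n%:R + 1 + s ^+ 2) / (2 * (r - 1)) -
   ((n%:R + 1 + s ^+ 2) / (2 * r) + (s / r) ^+ 2 / 2) =
   (r * (n%:R + 1) + s ^+ 2) / (2 * r ^+ 2 * (r - 1)).
  by field; rewrite !gt_eqF //; lra.
by rewrite divr_ge0 // ?addr_ge0 // ?mulr_ge0 ?exprn_ge0 //; lra.
Qed.

Definition spin_product (R : realType) n (u : n.-tuple bool) (e : pair n) : R :=
  (-1) ^+ tnth u (val e).1 * (-1) ^+ tnth u (val e).2.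

(** The square of the sum contains each product over i < j twice, and the
    diagonal terms are non-negative. *)
Lemma sum_spin_product_le (R : realType) n (u : n.-tuple bool) :
  2 * \sum_e spin_product R u e <= (\sum_i (-1) ^+ tnth u i) ^+ 2.
Proof.
pose x i : R := (-1) ^+ tnth u i.
have lt_sum : \sum_e spin_product R u e =
    \sum_(i < n) \sum_(j < n | (i < j)%N) x i * x j.
  rewrite pair_big_dep (big_sub [pred p : 'I_n * 'I_n | (p.1 < p.2)%N]) /=.
  by apply: eq_bigr => e _.
have gt_sum : \sum_e spin_product R u e =
    \sum_(i < n) \sum_(j < n | (j < i)%N) x i * x j.
  rewrite lt_sum (exchange_big_dep predT) //=.
  by apply: eq_bigr => i _; apply: eq_bigr => j _; rewrite mulrC.
rewrite mulrDl mul1r {1}lt_sum gt_sum -big_split /= expr2 mulr_suml.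
apply: ler_sum => i _; rewrite mulr_sumr.
rewrite [leRHS](bigID (fun j : 'I_n => (i < j)%N)) /= lerD2l.
rewrite [leRHS](bigD1 i) ?ltnn //=.
rewrite [X in _ <= _ + X](eq_bigl (fun j : 'I_n => (j < i)%N)).
  by rewrite lerDr -expr2 sqr_ge0.
by move=> j; rewrite -leqNgt ltn_neqAle andbC.
Qed.

(** Each factor 1 + x is at most exp x; multiplying these bounds needs the
    factors to be non-negative, whence a <= 1. *)
Lemma sum_prod_spin_product_le (R : realType) n (a m : R) :
  0 <= a <= 1 -> a <= m^-1 -> n%:R < m ->
  \sum_(u : n.-tuple bool) \prod_e (1 + a * spin_product R u e)
    <= 2 ^+ n * expR (n%:R / (2 * (m - n%:R))).
Proof.
move=> /andP[a0 a1] am nm.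
have := sum_expR_sqr_le 0 nm; rewrite expr0n /= addr0; apply: le_trans.
apply: ler_sum => u _; rewrite add0r.
have spin1 e : -1 <= a * spin_product R u e.
  rewrite /spin_product -signr_addb.
  by case: (_ (+) _); rewrite ?expr1 ?expr0; lra.
apply: (@le_trans _ _ (\prod_e expR (a * spin_product R u e))).
  apply: ler_prod => e _; rewrite expR_ge1Dx andbT.
  by have := spin1 e; lra.
rewrite -expR_sum ler_expR -mulr_sumr.
have := sum_spin_product_le R u; set S := (_ ^+ 2); set P := \sum_e _ => PS.
have S0 : 0 <= S by exact: sqr_ge0.
apply: (@le_trans _ _ (a * (S / 2))).
  by apply: ler_wpM2l => //; lra.
have -> : S / (2 * m) = m^-1 * (S / 2) by rewrite invfM; ring.
by apply: ler_wpM2r => //; lra.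
Qed.

(** Xor with s is an involution: the product of a fixed and a uniform spin
    vector is uniform. *)
Lemma sum_tuple_addb (R : realType) n (F : n.-tuple bool -> R)
    (s : n.-tuple bool) :
  \sum_t F [tuple tnth s i (+) tnth t i | i < n] = \sum_u F u.
Proof.
rewrite [RHS](reindex
  (fun t : n.-tuple bool => [tuple tnth s i (+) tnth t i | i < n])) //.
apply: onW_bij; apply: inv_bij => t.
by apply: eq_from_tnth => i; rewrite !tnth_mktuple addKb.
Qed.

Lemma spin_productM (R : realType) n (s t : n.-tuple bool) e :
  spin_product R s e * spin_product R t e =
  spin_product R [tuple tnth s i (+) tnth t i | i < n] e.
Proof. by rewrite /spin_product !tnth_mktuple !signr_addb mulrACA. Qed.

(** * Random graphs whose kernel is constant on half-squares *)

(** The point 1 / 2 is left out of both halves, since [kernel2] takes its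
    off-diagonal value wherever one coordinate is 1 / 2. *)
Definition unit_half (R : realType) (b : bool) : set (measurableTypeR R) :=
  if b then `]2^-1, 1]%classic else `[0, 2^-1[%classic.

Arguments unit_half R b : clear implicits.

Definition half_box (R : realType) n (s : n.-tuple bool) :
    set (n.-tuple (measurableTypeR R)) :=
  [set x | forall i, unit_half R (tnth s i) (tnth x i)]%classic.

Arguments half_box R {n} s.

Lemma measurable_half (R : realType) b : measurable (unit_half R b).
Proof. by case: b; exact: measurable_itv. Qed.

Lemma unit_half_sub (R : realType) b (x : R) : unit_half R b x -> unit_itv x.
Proof.
rewrite /unit_itv; case: b; rewrite /unit_half /= !in_itv /= => /andP[? ?];
  apply/andP; split; lra.
Qed.

Lemma unit_half_inj (R : realType) a b (x : R) :
  unit_half R a x -> unit_half R b x -> a = b.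
Proof.
case: a; case: b => //; rewrite /unit_half /= !in_itv /=;
  by move=> /andP[? ?] /andP[? ?]; exfalso; lra.
Qed.

Lemma measurable_half_box (R : realType) n (s : n.-tuple bool) :
  measurable (half_box R s).
Proof.
rewrite (_ : half_box R s =
    \bigcap_(i in [set: 'I_n])
      ((fun x => tnth x i) @^-1` unit_half R (tnth s i)))%classic.
  apply: fin_bigcap_measurable => // i _.
  rewrite -[X in measurable X]setTI.
  by apply: measurable_tnth => //; exact: measurable_half.
by apply/seteqP; split => x h i; [move=> _|]; exact: (h i).
Qed.

Lemma uniform_prob_half (R : realType) b :
  uniform_prob (@ltr01 R) (unit_half R b) = (2^-1)%:E.
Proof.
rewrite /uniform_prob integral_uniform_pdf.
have -> : (unit_half R b `&` `[0, 1] = unit_half R b)%classic.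
  by apply: setIidl => x /unit_half_sub.
rewrite (eq_integral (fun=> 1%:E)); last first.
  move=> x; rewrite inE => /unit_half_sub.
  rewrite /unit_itv /= in_itv /uniform_pdf /= => ->.
  by rewrite subr0 invr1.
have h0 : 0 < 2^-1 :> R by rewrite invr_gt0.
have h1 : 2^-1 < 1 :> R by rewrite invf_lt1 // ltr1n.
rewrite integral_cst; last exact: measurable_half.
rewrite mul1e; case: b.
  transitivity (lebesgue_measure (`]2^-1, 1]%classic : set R)) => //.
  by rewrite lebesgue_measure_itv /= lte_fin h1 -EFinD; congr _%:E; field.
transitivity (lebesgue_measure (`[0, 2^-1[%classic : set R)) => //.
by rewrite lebesgue_measure_itv /= lte_fin h0 -EFinD subr0.
Qed.

Lemma uniform_cube_half_box (R : realType) n (s : n.-tuple bool) :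
  uniform_cube R n (half_box R s) = ((2^-1) ^+ n)%:E.
Proof.
elim: n s => [|n IH] s.
  by rewrite /uniform_cube /= diracE mem_set // => -[].
rewrite /uniform_cube /= /distribution /pushforward.
rewrite (_ : _ @^-1` _ =
    unit_half R (thead s) `*` half_box R [tuple of behead s])%classic;
  last first.
  apply/seteqP; split => -[x t] /=.
    move=> h; split; first exact: (h ord0).
    by move=> i; have := h (lift ord0 i); rewrite tnthS tnth_lift0.
  move=> [hx ht] i; case: (unliftP ord0 i) => [j ->|-> //].
  by rewrite tnthS tnth_lift0; exact: (ht j).
rewrite product_measure1E //.
- rewrite -/(uniform_cube R n) [X in (_ * X)%E]IH exprS EFinM.
  by congr (_ * _)%E; exact: uniform_prob_half.
- exact: measurable_half.
- exact: measurable_half_box.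
Qed.

Definition block_edge_weight (R : realType) (K : bool -> bool -> R) n
    (s : n.-tuple bool) (e : pair n) (b : bool) : R :=
  let r := Num.max 0
    (Num.min 1 (K (tnth s (val e).1) (tnth s (val e).2) / n%:R)) in
  if b then r else 1 - r.

(** On each of the 2 ^ n boxes of half-intervals the conditional probability of
    a graph is constant, and the boxes have volume 2 ^ - n.  Points with a
    coordinate 1 / 2 lie in no box, so integrating over the boxes gives only one
    inequality; it is an equality because both sides are probability laws. *)
Lemma random_graph_block (R : realType) (k : graph_kernel R)
    (K : bool -> bool -> R) n (G : sgraph n) :
  (forall a b x y, unit_half R a x -> unit_half R b y -> k x y = K a b) ->
  random_graph k n G =
    (2^-1) ^+ n *
      \sum_(s : n.-tuple bool) edge_product (block_edge_weight K s) G.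
Proof.
move=> kK.
pose rhs (H : sgraph n) := (2^-1) ^+ n *
  \sum_(s : n.-tuple bool) edge_product (block_edge_weight K s) H.
have box_const (s : n.-tuple bool) x (H : sgraph n) : half_box R s x ->
    graph_cond_prob k x H = edge_product (block_edge_weight K s) H.
  move=> sx; rewrite /edge_product /graph_cond_prob.
  rewrite (big_sub [pred p : 'I_n * 'I_n | (p.1 < p.2)%N]) /=.
  apply: eq_bigr => e _; rewrite /block_edge_weight /edge_prob.
  rewrite (kK _ _ _ _ (sx _) (sx _)).
  by case: ifP.
have rhs_le H : rhs H <= random_graph k n H.
  rewrite -lee_fin /= /random_graph_prob /Rintegral fineK; last first.
    apply: integrable_fin_num; first exact: measurable_unit_cube.
    exact: integrable_graph_cond_prob.
  pose U :=
    (\big[setU/set0]_(s <- index_enum {: n.-tuple bool}) half_box R s)%classic.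
  have mU : measurable U.
    by apply: bigsetU_measurable => s _; exact: measurable_half_box.
  have subU : (U `<=` @unit_cube R n)%classic.
    by rewrite /U -bigcup_seq => x [s _ sx] i; exact: unit_half_sub (sx i).
  have mf : measurable_fun (@unit_cube R n)
      (EFin \o (graph_cond_prob k (n := n)) ^~ H).
    by apply/measurable_EFinP; exact: measurable_graph_cond_prob.
  apply: (@le_trans _ _
    (\int[uniform_cube R n]_(x in U) (graph_cond_prob k x H)%:E)%E); last first.
    apply: ge0_subset_integral => //; first exact: measurable_unit_cube.
    by move=> x _; rewrite lee_fin graph_cond_prob_ge0.
  rewrite integral_bigsetU_EFin //; last 4 first.
  - by move=> s; exact: measurable_half_box.
  - exact: index_enum_uniq.
  - move=> s t _ _ [x [sx tx]]; apply: eq_from_tnth => i.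
    exact: unit_half_inj (sx i) (tx i).
  - exact: (measurable_funS (@measurable_unit_cube R n) subU mf).
  rewrite /rhs mulr_sumr -sumEFin; apply: lee_sum => s _.
  rewrite (eq_integral (fun=> (edge_product (block_edge_weight K s) H)%:E)).
    rewrite integral_cst; last exact: measurable_half_box.
    by rewrite [X in (_ * X)%E]uniform_cube_half_box -EFinM mulrC.
  by move=> x /set_mem sx; rewrite (box_const s).
(* Equality of the total masses upgrades rhs_le to the claim. *)
have rhs_sum : \sum_H rhs H = 1.
  rewrite -mulr_sumr exchange_big /=.
  under eq_bigr => s _.
    rewrite sum_edge_product big1; last by move=> e _; rewrite addrC subrK.
    over.
  rewrite sumr_const card_tuple card_bool -mulr_natr mul1r natrX -exprMn.
  by rewrite mulVf ?expr1n.
apply/eqP; rewrite eq_le rhs_le andbT -subr_ge0.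
have : \sum_H (random_graph k n H - rhs H) = 0.
  by rewrite sumrB rhs_sum (law_sum1 (random_graph k n)) subrr.
move=> /psumr_eq0P h; rewrite subr_ge0 -subr_le0 h // => H _.
by rewrite subr_ge0.
Qed.

(** * The two graph laws and their likelihood ratio *)

Lemma lawQ_edge_product (R : realType) (c : R) n (G : sgraph n) :
  0 <= c <= n%:R -> (0 < n)%N ->
  lawQ c n G = edge_product
    (fun (_ : pair n) (b : bool) => if b then c / n%:R else 1 - c / n%:R) G.
Proof.
move=> /andP[c0 cn] n0; have n0' : 0 < n%:R :> R by rewrite ltr0n.
rewrite [LHS](@random_graph_block _ (kernel1 c) (fun _ _ => c)) //.
under eq_bigr => s _.
  have -> : edge_product (block_edge_weight (fun _ _ => c) s) G = edge_product
      (fun (_ : pair n) (b : bool) => if b then c / n%:R else 1 - c / n%:R) G.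
    apply: eq_bigr => e _; rewrite /block_edge_weight min_r; last first.
      by rewrite ler_pdivrMr // mul1r.
    by rewrite max_r // divr_ge0 // ltW.
  over.
rewrite sumr_const card_tuple card_bool -[_ *+ (2 ^ n)]mulr_natl mulrA natrX.
rewrite -exprMn.
by rewrite mulVf ?expr1n ?mul1r.
Qed.

Definition spin_edge_weight (R : realType) (p d : R) n (s : n.-tuple bool)
    (e : pair n) (b : bool) : R :=
  if b then p + d * spin_product R s e else 1 - (p + d * spin_product R s e).

Lemma kernel2_half (R : realType) (c delta : R) a b x y :
  unit_half R a x -> unit_half R b y ->
  kernel2 c delta x y = c + delta * ((-1) ^+ a * (-1) ^+ b).
Proof.
move=> xa yb; rewrite /= /kernel2_fun.
have -> : ((x, y) \in @off_diagonal_blocks R) = (a (+) b).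
  apply/idP/idP; rewrite inE /off_diagonal_blocks /= !in_itv /=.
    case: a b xa yb => [] [] //=; rewrite !in_itv /= => /andP[? ?] /andP[? ?];
    by case=> -[/andP[? ?] /andP[? ?]]; exfalso; lra.
  case: a b xa yb => [] [] //=; rewrite !in_itv /= => /andP[? ?] /andP[? ?] _;
    [right|left]; split; apply/andP; split; lra.
by case: a b xa yb => [] [] _ _ /=; ring.
Qed.

Lemma lawP_edge_product (R : realType) (c delta : R) n (G : sgraph n) :
  0 <= delta <= c -> c + delta <= n%:R -> (0 < n)%N ->
  lawP c delta n G = (2^-1) ^+ n *
    \sum_s edge_product (spin_edge_weight (c / n%:R) (delta / n%:R) s) G.
Proof.
move=> /andP[d0 dc] cn n0; have n0' : 0 < n%:R :> R by rewrite ltr0n.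
rewrite [LHS](random_graph_block _ (@kernel2_half _ c delta)).
congr (_ * _); apply: eq_bigr => s _; apply: eq_bigr => e _.
rewrite /block_edge_weight /spin_edge_weight -/(spin_product R s e).
have -> : c / n%:R + delta / n%:R * spin_product R s e =
    (c + delta * spin_product R s e) / n%:R by field; rewrite gt_eqF.
have [h0 h1] : 0 <= c + delta * spin_product R s e /\
    c + delta * spin_product R s e <= n%:R.
  rewrite /spin_product -signr_addb.
  by case: (_ (+) _); rewrite ?expr1 ?expr0; split; lra.
by rewrite min_r ?max_r ?ler_pdivrMr ?mul1r // divr_ge0 // ltW.
Qed.

(** The square of a mixture is a double mixture of products, divided by the
    product law q; the sum over graphs then factors over the edges, each edge
    contributing 1 + d ^ 2 / (p (1 - p)) times the product of its four spins. *)
Lemma sum_spin_mixture_sqr_le (R : realType) n (p d m : R) :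
  0 < p < 1 -> d ^+ 2 / (p * (1 - p)) <= 1 ->
  d ^+ 2 / (p * (1 - p)) <= m^-1 -> n%:R < m ->
  \sum_(G : sgraph n)
      ((2^-1) ^+ n * \sum_s edge_product (spin_edge_weight p d s) G) ^+ 2 /
      edge_product (fun (_ : pair n) (b : bool) => if b then p else 1 - p) G
    <= expR (n%:R / (2 * (m - n%:R))).
Proof.
move=> /andP[p0 p1] a1 am nm; set a := d ^+ 2 / _ in a1 am *.
have q0 : 0 < 1 - p by rewrite subr_gt0.
have a0 : 0 <= a by rewrite divr_ge0 ?sqr_ge0 // mulr_ge0 ?ltW.
pose q (b : bool) := if b then p else 1 - p.
have sqE (G : sgraph n) :
    ((2^-1) ^+ n * \sum_s edge_product (spin_edge_weight p d s) G) ^+ 2 /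
      edge_product (fun (_ : pair n) (b : bool) => if b then p else 1 - p) G =
    (2^-1) ^+ n * (2^-1) ^+ n * \sum_s \sum_t edge_product (fun e b =>
       spin_edge_weight p d s e b * spin_edge_weight p d t e b / q b) G.
  rewrite exprMn !expr2 -[LHS]mulrA; congr (_ * _).
  rewrite mulr_suml mulr_suml; apply: eq_bigr => s _.
  rewrite mulr_sumr mulr_suml; apply: eq_bigr => t _.
  rewrite edge_productM /edge_product -prodfV -big_split.
  apply: eq_bigr => e _ /=.
  by case: (_ \in _).
rewrite (eq_bigr _ (fun G _ => sqE G)) -mulr_sumr exchange_big /=.
have edgeE s t (e : pair n) :
    spin_edge_weight p d s e true * spin_edge_weight p d t e true / q true +
    spin_edge_weight p d s e false * spin_edge_weight p d t e false / q false =
    1 + a * spin_product R [tuple tnth s i (+) tnth t i | i < n] e.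
  rewrite -spin_productM /spin_edge_weight /q /a.
  by field; rewrite !gt_eqF.
under eq_bigr => s _.
  rewrite exchange_big /=.
  under eq_bigr do
    rewrite sum_edge_product (eq_bigr _ (fun e _ => edgeE _ _ e)).
  rewrite (sum_tuple_addb (fun u => \prod_e (1 + a * spin_product R u e)) s).
  over.
rewrite sumr_const card_tuple card_bool -[_ *+ (2 ^ n)]mulr_natl natrX.
have two_n : (2^-1) ^+ n * 2 ^+ n = 1 :> R by rewrite -exprMn mulVf ?expr1n.
set X := \sum_u _; set K := expR _.
have -> : (2^-1) ^+ n * (2^-1) ^+ n * (2 ^+ n * X) =
    (2^-1) ^+ n * ((2^-1) ^+ n * 2 ^+ n) * X by ring.
have -> : K = (2^-1) ^+ n * (2 ^+ n * K) by rewrite mulrA two_n mul1r.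
rewrite two_n mulr1 ler_wpM2l ?exprn_ge0 ?invr_ge0 //.
by apply: sum_prod_spin_product_le; rewrite // a0.
Qed.

(** * From the second moment to the coupling *)

(** The case L = P / Q, whose variance is the chi-square divergence of P from
    Q. *)
Lemma coupling_transport (R : realType) (T : finType) (P Q : law R T)
    (d : T -> T -> R) (v t : R) :
  (forall x, 0 < Q x) -> 0 < t -> transport_inequality Q d v ->
  exists mu : law R (T * T)%type, coupling P Q mu /\
    2 * law_expectation mu (fun z => d z.1 z.2)
      <= t * (\sum_x P x ^+ 2 / Q x - 1) + v / t.
Proof.
move=> Q0 t0 tr.
have QL x : Q x * (P x / Q x) = P x by rewrite mulrC divfK // gt_eqF.
have [mu [mu0 mu1 mu2 mu3]] := tr (fun x => P x / Q x) t
  (fun x => divr_ge0 (law_ge0 P x) (law_ge0 Q x)) t0.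
have m1 : \sum_x Q x * (P x / Q x) = 1.
  by under eq_bigr do rewrite QL; exact: law_sum1.
have musum : \sum_(z : T * T) mu z.1 z.2 = 1.
  by rewrite sum_pair; under eq_bigr do rewrite mu1.
exists (Law (fun z => mu0 z.1 z.2) musum); split.
  by split=> x /=; rewrite ?mu1 ?QL // mu2 m1 mul1r.
rewrite /law_expectation sum_pair /=; apply: le_trans mu3 _.
rewrite m1 expr1n (eq_bigr (fun x => P x ^+ 2 / Q x)) // => x _.
by field; rewrite gt_eqF.
Qed.

(** The independent coupling; it takes care of small n. *)
Lemma coupling_expectation_le (R : realType) (S T : finType) (P : law R S)
    (Q : law R T) (f : S * T -> R) (M : R) : (forall z, f z <= M) ->
  exists mu : law R (S * T)%type, coupling P Q mu /\ law_expectation mu f <= M.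
Proof.
move=> fM.
have mu0 (z : S * T) : 0 <= P z.1 * Q z.2 by rewrite mulr_ge0 ?law_ge0.
have mu1 : \sum_(z : S * T) P z.1 * Q z.2 = 1.
  rewrite sum_pair -(law_sum1 P); apply: eq_bigr => x _ /=.
  by rewrite -mulr_sumr law_sum1 mulr1.
exists (Law mu0 mu1); split.
  split=> x /=; first by rewrite -mulr_sumr law_sum1 mulr1.
  by rewrite -mulr_suml law_sum1 mul1r.
rewrite -[M]mul1r -mu1 mulr_suml; apply: ler_sum => z _ /=.
by apply: ler_wpM2l.
Qed.

Lemma card_pair_le n : (#|{: pair n}| <= n ^ 2)%N.
Proof.
by rewrite card_sig (leq_trans (max_card _)) // card_prod card_ord mulnn.
Qed.

Lemma edit_distance_le n (G H : sgraph n) :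
  (edit_distance G H <= symdiff_card G H)%N.
Proof. by have [_ ->] := edit_distance_min G H; last exact: isomorphic_refl. Qed.

(** The hypothesis on delta ^ 2 * m says that the coefficient
    a = delta ^ 2 / (c (n - c)) is at most 1 / m.  The transport bound is
    used with t = sqrt n, which balances a variance of order 1 against a total edge
    variance of order n. *)
Lemma coupling_large_graph (R : realType) (c delta m : R) n :
  0 <= delta <= c -> 0 < c -> c + delta <= n%:R -> c < n%:R -> n%:R < m ->
  delta ^+ 2 * m <= c * (n%:R - c) ->
  exists mu : law R (sgraph n * sgraph n)%type,
    coupling (lawP c delta n) (lawQ c n) mu /\
    law_expectation mu (fun GH => (edit_distance GH.1 GH.2)%:R)
      <= (expR (n%:R / (2 * (m - n%:R))) + c) * Num.sqrt n%:R.
Proof.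
move=> d0c c0 cdn cn nm dm.
have n0 : 0 < n%:R :> R by lra.
have n0' : (0 < n)%N by rewrite -(ltr0n R).
have m0 : 0 < m by lra.
have n1 : 1 <= n%:R :> R by rewrite ler1n.
pose p := c / n%:R.
have p0 : 0 < p by rewrite divr_gt0.
have p1 : p < 1 by rewrite ltr_pdivrMr // mul1r.
have cn01 : 0 <= c <= n%:R by rewrite !ltW.
have p01 : 0 <= p <= 1 by rewrite !ltW.
have QE G := lawQ_edge_product G cn01 n0'.
have Q0 G : 0 < lawQ c n G.
  by rewrite QE; apply: prodr_gt0 => e _; case: ifP; rewrite ?subr_gt0.
have aE : (delta / n%:R) ^+ 2 / (p * (1 - p)) = delta ^+ 2 / (c * (n%:R - c)).
  rewrite /p; field; rewrite !gt_eqF // ?subr_gt0 //.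
have am : (delta / n%:R) ^+ 2 / (p * (1 - p)) <= m^-1.
  rewrite aE ler_pdivrMr ?mulr_gt0 ?subr_gt0 // mulrC.
  by rewrite ler_pdivlMr.
have chi2 : \sum_G lawP c delta n G ^+ 2 / lawQ c n G <=
    expR (n%:R / (2 * (m - n%:R))).
  under eq_bigr do rewrite lawP_edge_product // QE.
  apply: sum_spin_mixture_sqr_le => //; first by rewrite p0.
  by apply: le_trans am _; rewrite invf_le1 //; lra.
have tr := transport_inequality_gnp (n := n) p01.
have {}tr : transport_inequality (lawQ c n) (fun G H => (symdiff_card G H)%:R)
    (#|{: pair n}|%:R * (p * (1 - p))).
  apply: (transport_inequality_bij (f := id)) tr => //; first by exists id.
pose t : R := Num.sqrt n%:R.
have t0 : 0 < t by rewrite sqrtr_gt0.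
have t2 : t ^+ 2 = n%:R by rewrite sqr_sqrtr // ltW.
have [mu [cmu mu_le]] := coupling_transport (lawP c delta n) Q0 t0 tr.
exists mu; split=> //; rewrite -/t.
set E := law_expectation _ _ in mu_le.
apply: (@le_trans _ _ E).
  apply: ler_sum => z _; apply: ler_wpM2l; first exact: law_ge0.
  by rewrite ler_nat edit_distance_le.
have v_le : #|{: pair n}|%:R * (p * (1 - p)) / t <= c * t.
  rewrite ler_pdivrMr //.
  have -> : c * t * t = c * t ^+ 2 by ring.
  have -> : c * t ^+ 2 = (n ^ 2)%:R * p.
    by rewrite t2 /p natrX; field; rewrite gt_eqF.
  apply: ler_pM => //; first by rewrite mulr_ge0 // ?ltW // subr_gt0.
    by rewrite ler_nat card_pair_le.
  by rewrite ler_piMr ?ltW // ltrBlDr ltrDl.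
have chi2' := ler_wpM2l (ltW t0) chi2.
have E0 : 0 <= E.
  by apply: sumr_ge0 => z _; rewrite mulr_ge0 ?law_ge0.
by move: mu_le v_le chi2' E0; lra.
Qed.

Theorem theorem1p2 (R : realType) (c delta : R)
    (hdelta : 0 <= delta <= c) (hsqrt : delta < Num.sqrt c) :
  exists C : R, forall n : nat, (1 <= n)%N ->
    exists mu : law R (sgraph n * sgraph n)%type,
      coupling (lawP c delta n) (lawQ c n) mu /\
      law_expectation mu (fun GH => (edit_distance GH.1 GH.2)%:R)
        <= C * Num.sqrt n%:R.
Proof.
have /andP[d0 dc] := hdelta.
have c0 : 0 < c by rewrite -sqrtr_gt0 (le_lt_trans d0).
have d2c : delta ^+ 2 < c.
  by rewrite -[ltRHS]sqr_sqrtr ?(ltW c0) // ltr_pXn2r // nnegrE sqrtr_ge0.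
pose lam := delta ^+ 2 / c.
have lam0 : 0 <= lam by rewrite divr_ge0 ?sqr_ge0 // ltW.
have lam1 : lam < 1 by rewrite ltr_pdivrMr // mul1r.
have dE : delta ^+ 2 = lam * c by rewrite /lam divfK // gt_eqF.
pose th := (1 + lam) / 2.
have [th0 th1] : 0 < th /\ th < 1 by rewrite /th; split; lra.
(* Beyond N all edge probabilities lie in [0, 1], and th, halfway between lam
   and 1, absorbs the correction n - c in the denominator of a. *)
pose N := (Num.truncn (2 * c / (1 - lam))).+1.
have N_gt : 2 * c / (1 - lam) < N%:R by apply: truncnS_gt.
pose M := (\max_(k < N) #|{: {set 'I_k}}|)%N.
pose K := expR (th / (2 * (1 - th))).
have K0 : 0 <= K by exact: expR_ge0.
exists (K + c + M%:R) => n n1.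
have n1R : 1 <= n%:R :> R by rewrite ler1n.
have t1 : 1 <= Num.sqrt (n%:R : R) by rewrite -[leLHS]sqrtr1 ler_wsqrtr.
have [nN|Nn] := ltnP n N.
  have [z|mu [cmu mu_le]] := coupling_expectation_le (lawP c delta n) (lawQ c n)
    (f := fun GH : sgraph n * sgraph n => (edit_distance GH.1 GH.2)%:R)
    (M := M%:R).
    rewrite ler_nat; apply: leq_trans (edit_distance_le _ _) _.
    apply: leq_trans (max_card _) _.
    exact: (leq_bigmax (F := fun k : 'I_N => #|{: {set 'I_k}}|) (Ordinal nN)).
  exists mu; split=> //; apply: le_trans mu_le _.
  rewrite -[leLHS]mulr1; apply: ler_pM => //; lra.
have {}N_gt : 2 * c / (1 - lam) < n%:R by rewrite (lt_le_trans N_gt) // ler_nat.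
have cn : 2 * c < (1 - lam) * n%:R.
  by rewrite [ltRHS]mulrC -ltr_pdivrMr ?subr_gt0.
have lamn : 0 <= lam * n%:R by rewrite mulr_ge0.
have nm : n%:R < n%:R / th :> R by rewrite ltr_pdivlMr // gtr_pMr //; lra.
have dm : delta ^+ 2 * (n%:R / th) <= c * (n%:R - c).
  have -> : delta ^+ 2 * (n%:R / th) = c * (lam * n%:R / th).
    by rewrite dE; ring.
  rewrite ler_pM2l // ler_pdivrMr // mulrBl.
  have : c * th <= c by rewrite ler_piMr // ltW.
  by rewrite /th; lra.
have [] := coupling_large_graph hdelta c0 _ _ nm dm; [lra|lra|].
move=> mu [cmu mu_le]; exists mu; split=> //; apply: le_trans mu_le _.
have -> : n%:R / (2 * (n%:R / th - n%:R)) = th / (2 * (1 - th)).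
  have nth : 0 < n%:R * (1 - th) by rewrite mulr_gt0 //; lra.
  by field; apply/and3P; split; rewrite gt_eqF //; lra.
rewrite ler_wpM2r ?sqrtr_ge0 // -/K lerDl; exact: ler0n.
Qed.
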